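(* Let $m\ge 2$, $n\ge 2$, let $K_m$ be the complete graph on $m$ vertices and $P_n$ the path on $n$ vertices, and let $\Delta$ be the maximum degree of $K_m\times P_n$. Then $\chi''_{\Sigma}(K_m\times P_n)=\Delta+2$.
   Context: All graphs are finite and simple. A proper total $k$-coloring of a graph $G$ assigns to every vertex and every edge a color from $\{1,\dots,k\}$ such that adjacent vertices receive different colors, edges sharing an endpoint receive different colors, and no edge receives the same color as either of its endpoints. For such a coloring $c$ and a vertex $v$, let $f(v)=c(v)+\sum_{e\ni v} c(e)$. The coloring distinguishes adjacent vertices by sums if $f(u)\neq f(v)$ for every edge $uv$. $\chi''_{\Sigma}(G)$ denotes the smallest $k$ such that $G$ has a proper total $k$-coloring distinguishing adjacent vertices by sums. The product $G_1\times G_2$ is the Cartesian product: vertex set $V(G_1)\times V(G_2)$, with $(u_1,u_2)$ adjacent to $(v_1,v_2)$ iff either $u_1=v_1$ and $u_2v_2\in E(G_2)$, or $u_1v_1\in E(G_1)$ and $u_2=v_2$. *)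

(* Defs.v *)
From mathcomp Require Import all_boot.

Set Implicit Arguments.
Unset Strict Implicit.
Unset Printing Implicit Defensive.

Record sgraph := SGraph {
  svertex :> finType;
  adj : rel svertex;
  adj_sym : symmetric adj;
  adj_irrefl : irreflexive adj
}.

Arguments adj {s} _ _.

Section Graph.
Variable G : sgraph.

Definition edge_set : {set {set G}} :=
  [set e | [exists x : G, exists y : G, adj x y && (e == [set x; y])]].

Definition edge := {e : {set G} | e \in edge_set}.

Definition degree (v : G) : nat := #|[set w : G | adj v w]|.

Definition max_degree : nat := \max_(v : G) degree v.

(* An element i of 'I_k stands for the color i.+1, so that the colors are
   1, ..., k; this shift matters for the sums [color_sum]. *)
Definition total_assignment (k : nat) := {ffun G + edge -> 'I_k}.

Section Coloring.
Variables (k : nat) (c : total_assignment k).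

Definition vcolor (v : G) : nat := (c (inl v)).+1.
Definition ecolor (e : edge) : nat := (c (inr e)).+1.

Definition proper_total_coloring : bool :=
  [&& [forall u : G, forall v : G, adj u v ==> (vcolor u != vcolor v)],
      [forall e : edge, forall e' : edge,
         (e != e') && (val e :&: val e' != set0) ==> (ecolor e != ecolor e')]
    & [forall v : G, forall e : edge,
         (v \in val e) ==> (vcolor v != ecolor e)]].

Definition color_sum (v : G) : nat :=
  vcolor v + \sum_(e : edge | v \in val e) ecolor e.

Definition sum_distinguishing : bool :=
  [forall u : G, forall v : G, adj u v ==> (color_sum u != color_sum v)].

End Coloring.

Definition has_sum_total_coloring (k : nat) : bool :=
  [exists c : total_assignment k,
     proper_total_coloring c && sum_distinguishing c].

(* Edges get distinct colors 1, ..., q; vertices get distinct nonzero multiples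
   of M := (q * q).+1, which exceeds any sum of edge colors. *)
Lemma ex_sum_total_coloring : exists k, has_sum_total_coloring k.
Proof.
pose q := #|{: edge}|; pose M := (q * q).+1.
pose vc (v : G) := (enum_rank v).+1 * M.
pose ec (e : edge) : nat := (enum_rank e).+1.
pose g (x : G + edge) := match x with inl v => vc v | inr e => ec e end.
pose k := (\max_x g x).+1.
have g_gt0 x : 0 < g x by case: x => x //=; rewrite /vc muln_gt0.
have g_lt x : (g x).-1 < k.
  by rewrite ltnS (leq_trans (leq_pred _)) // leq_bigmax.
pose c : total_assignment k := [ffun x => Ordinal (g_lt x)].
have cv v : vcolor c v = vc v by rewrite /vcolor ffunE /= (prednK (g_gt0 (inl v))).
have ce e : ecolor c e = ec e by rewrite /ecolor ffunE.
have ec_le e : ec e <= q by exact: ltn_ord.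
have ecM e : ec e < M.
  rewrite ltnS (leq_trans (ec_le e)) // leq_pmulr //.
  exact: leq_ltn_trans (ec_le e).
have sM v : \sum_(e : edge | v \in val e) ecolor c e < M.
  rewrite ltnS; apply: (@leq_trans (\sum_(e : edge | v \in val e) q)).
    by apply: leq_sum => e _; rewrite ce.
  by rewrite sum_nat_const leq_mul2r max_card orbT.
have fdiv v : color_sum c v %/ M = (enum_rank v).+1.
  by rewrite /color_sum cv /vc divnMDl // divn_small ?addn0.
have adjN u v : adj u v -> u != v.
  by apply: contraTneq => ->; rewrite adj_irrefl.
exists k; apply/existsP; exists c; apply/andP; split; first (apply/and3P; split).
- apply/forallP=> u; apply/forallP=> v; apply/implyP=> /adjN; apply: contraNneq.
  rewrite !cv => /eqP; rewrite eqn_pmul2r // eqSS => /eqP h.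
  by apply/eqP/enum_rank_inj/val_inj.
- apply/forallP=> e; apply/forallP=> e'; apply/implyP=> /andP[+ _].
  apply: contraNneq; rewrite !ce => -[h].
  by apply/eqP/enum_rank_inj/val_inj.
- apply/forallP=> v; apply/forallP=> e; apply/implyP=> _.
  rewrite cv ce neq_ltn orbC (leq_trans (ecM e)) //.
  by rewrite /vc leq_pmull.
apply/forallP=> u; apply/forallP=> v; apply/implyP=> /adjN; apply: contraNneq.
move/(congr1 (divn^~ M)); rewrite !fdiv => -[h].
by apply/eqP/enum_rank_inj/val_inj.
Qed.

Definition chi_sum_total : nat := ex_minn ex_sum_total_coloring.

End Graph.

Definition complete_adj (m : nat) : rel 'I_m := fun i j => i != j.

Lemma complete_adj_sym m : symmetric (@complete_adj m).
Proof. by move=> i j; rewrite /complete_adj eq_sym. Qed.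

Lemma complete_adj_irrefl m : irreflexive (@complete_adj m).
Proof. by move=> i; rewrite /complete_adj eqxx. Qed.

Definition complete_graph (m : nat) : sgraph :=
  SGraph (@complete_adj_sym m) (@complete_adj_irrefl m).

Definition path_adj (n : nat) : rel 'I_n :=
  fun i j => (i.+1 == j :> nat) || (j.+1 == i :> nat).

Lemma path_adj_sym n : symmetric (@path_adj n).
Proof. by move=> i j; rewrite /path_adj orbC. Qed.

Lemma path_adj_irrefl n : irreflexive (@path_adj n).
Proof. by move=> i; rewrite /path_adj orbb gtn_eqF. Qed.

Definition path_graph (n : nat) : sgraph :=
  SGraph (@path_adj_sym n) (@path_adj_irrefl n).

Section CartesianProduct.
Variables G1 G2 : sgraph.

Definition cart_adj : rel (G1 * G2) := fun u v =>
  (u.1 == v.1) && adj u.2 v.2 || adj u.1 v.1 && (u.2 == v.2).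

Lemma cart_adj_sym : symmetric cart_adj.
Proof.
by move=> u v; rewrite /cart_adj (eq_sym u.1) (eq_sym u.2) !(adj_sym u.1, adj_sym u.2).
Qed.

Lemma cart_adj_irrefl : irreflexive cart_adj.
Proof. by move=> u; rewrite /cart_adj !adj_irrefl andbF. Qed.

Definition cart_prod : sgraph := SGraph cart_adj_sym cart_adj_irrefl.

End CartesianProduct.

(* Main.v *)
Require Import Defs.
From mathcomp Require Import all_boot.
From mathcomp Require Import zify.

(* Two adjacent vertices of maximum degree Delta force Delta + 2 colors: with
   Delta + 1 colors both would see every color, hence have equal sums.

   Conversely, let N be the odd number among m + 1 and m + 2.  In every copy of
   K_m, color the edge ij by i + j mod N.  At the vertex i the residues 2i and
   i - 1 remain free (and i - 2 if N = m + 2), and since N is odd each of them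
   is an injective function of i.  Use 2i as vertex color in the copies of even
   index and i - 1 in those of odd index, so that the other one is the color
   missing there.  The path edges leaving a copy of even index upwards take
   i - 2 (or the spare color m + 2 if m is even), those leaving a copy of odd
   index upwards take the color m + 3.  The color sums are governed by the
   missing residue, and in a last copy that lacks the color i - 2 by the sum
   2i - 3 of the two missing ones; both are again injective in i. *)

(** * Sum-distinguishing total colorings of an arbitrary graph *)

Section SumTotalColoring.
Set Implicit Arguments.
Unset Strict Implicit.
Variable G : sgraph.
Implicit Types u v w x y : G.

Lemma adj_neq u v : adj u v -> u != v.
Proof. by apply: contraTneq => ->; rewrite adj_irrefl. Qed.

Lemma edge_setP (e : {set G}) :
  reflect (exists x y, adj x y /\ e = [set x; y]) (e \in edge_set G).
Proof.
rewrite inE; apply: (iffP existsP) => [[x /existsP[y /andP[xy /eqP->]]]|].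
  by exists x, y.
by case=> x [y [xy ->]]; exists x; apply/existsP; exists y; rewrite xy eqxx.
Qed.

Lemma incident_edgeE (v : G) (e : {set G}) :
  e \in edge_set G -> v \in e -> exists2 w, adj v w & e = [set v; w].
Proof.
case/edge_setP=> x [y [xy ->]]; rewrite !inE => /orP[]/eqP->.
  by exists y.
by exists x; rewrite ?(adj_sym y) // setUC.
Qed.

Lemma set2_injr v : injective (fun w => [set v; w]).
Proof.
move=> w w' /= h; apply/eqP; move: (set22 v w) (set22 v w').
rewrite {1}h -{2}h !inE => /orP[/eqP->|//] /orP[/eqP->|/eqP->] //.
Qed.

(** Taking images in [{set G}] discards the membership proofs carried by [edge]; the incident edges
    are then parametrized injectively by the neighbors of [v]. *)
Lemma sum_incident_edges v (F : {set G} -> nat) :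
  \sum_(e : edge G | v \in val e) F (val e) =
  \sum_(w | adj v w) F [set v; w].
Proof.
pose A := [set e : edge G | v \in val e].
transitivity (\sum_(e in val @: A) F e).
  rewrite big_imset; last by move=> ? ? _ _; apply: val_inj.
  by apply: eq_bigl => e; rewrite inE.
transitivity (\sum_(e in (fun w => [set v; w]) @: [set w | adj v w]) F e).
  apply: eq_bigl => e; apply/imsetP/imsetP => [[[d dE]]|[w]]; rewrite inE.
    move=> /= vd ->; have [w vw ->] := incident_edgeE dE vd.
    by exists w; rewrite ?inE.
  move=> vw ->; have wE : [set v; w] \in edge_set G.
    by apply/edge_setP; exists v, w.
  by exists (exist (fun e => e \in edge_set G) _ wE); rewrite ?inE ?eqxx.
rewrite big_imset; last by move=> ? ? _ _; apply: set2_injr.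
by apply: eq_bigl => w; rewrite inE.
Qed.

Lemma sum_total_coloring_lb (u v : G) (k : nat) :
  adj u v -> degree u = degree v -> has_sum_total_coloring G k ->
  degree u + 2 <= k.
Proof.
move=> uv duv /existsP[c /andP[/and3P[_ Pe Pve] Ps]].
(* [A x] gathers x and its incident edges: properness makes [c] injective on it, and the color sum
   is a sum over it. *)
pose A x : {set G + edge G} :=
  inl x |: [set inr e | e in [set e : edge G | x \in val e]].
have xNA x : (inl x : G + edge G) \notin inr @: [set e : edge G | x \in val e].
  by apply/imsetP=> [[]].
have inr_inj (B : {set edge G}) : {in B &, injective (@inr G (edge G))}.
  by move=> ? ? _ _ [].
have sumA x (F : G + edge G -> nat) :
    \sum_(y in A x) F y = F (inl x) + \sum_(e : edge G | x \in val e) F (inr e).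
  rewrite big_setU1 //= big_imset //; congr addn.
  by apply: eq_bigl => e; rewrite inE.
have cardA x : #|A x| = (degree x).+1.
  rewrite -sum1_card sumA (sum_incident_edges x (fun=> 1)) sum1dep_card //.
have injA x : {in A x &, injective c}.
  move=> y z; rewrite !inE => /orP[/eqP->|/imsetP[e + ->]].
    case/orP => [/eqP->//|/imsetP[d + ->]]; rewrite inE => xd h.
    have /forallP/(_ x)/forallP/(_ d)/implyP/(_ xd) := Pve.
    by rewrite /vcolor /ecolor h eqxx.
  rewrite inE => xe; case/orP => [/eqP->//|/imsetP[d + ->]].
    move=> h; have /forallP/(_ x)/forallP/(_ e)/implyP/(_ xe) := Pve.
    by rewrite /vcolor /ecolor h eqxx.
  rewrite inE => xd h; congr inr; apply/eqP; apply: contraT => eNd.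
  have ed0 : (e != d) && (val e :&: val d != set0).
    by rewrite eNd; apply/set0Pn; exists x; rewrite inE xe.
  have /forallP/(_ e)/forallP/(_ d)/implyP/(_ ed0) := Pe.
  by rewrite /ecolor h eqxx.
have cardI x : #|c @: A x| = (degree x).+1 by rewrite card_in_imset.
have lek x : degree x < k.
  by rewrite -cardI -[k in _ <= k]card_ord max_card.
rewrite addn2 ltn_neqAle lek andbT; apply/negP => /eqP dk.
have full x : degree x = degree u -> color_sum c x = \sum_(i < k) i.+1.
  move=> dx; rewrite /color_sum -(sumA x (fun z => (c z).+1)).
  rewrite -(big_imset (fun i : 'I_k => i.+1)) //=; apply: eq_bigl => i.
  have /setP-> : c @: A x = setT.
    by apply/eqP; rewrite eqEcard subsetT cardsT card_ord cardI dx dk leqnn.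
  by rewrite in_setT.
have /forallP/(_ u)/forallP/(_ v)/implyP/(_ uv) := Ps.
by rewrite !full ?eqxx.
Qed.

(** Allows colorings to be built from plain functions on vertices and ordered pairs, without
    handling the type [edge]. Colors count from 0, so the bound [k] leaves [k.+1] of them. *)
Lemma sum_total_coloring_of (k : nat) (vc : G -> nat) (ec : G -> G -> nat) :
  (forall v, vc v <= k) ->
  (forall u v, adj u v -> ec u v <= k) ->
  (forall u v, adj u v -> ec u v = ec v u) ->
  (forall u v, adj u v -> vc u != vc v) ->
  (forall u v w, adj u v -> adj u w -> v != w -> ec u v != ec u w) ->
  (forall u v, adj u v -> vc u != ec u v) ->
  (forall u v, adj u v ->
     (vc u).+1 + \sum_(w | adj u w) (ec u w).+1 !=
     (vc v).+1 + \sum_(w | adj v w) (ec v w).+1) ->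
  has_sum_total_coloring G k.+1.
Proof.
move=> vck eck ecC vcP ecP vecP sumP.
(* An edge picks one ordering of its ends, immaterial by the symmetry of [ec]; the default 0 is
   never reached on an edge. *)
pose sc (e : {set G}) :=
  if [pick p : G * G | adj p.1 p.2 && (e == [set p.1; p.2])] is Some p
  then ec p.1 p.2 else 0.
have scE x y : adj x y -> sc [set x; y] = ec x y.
  move=> xy; rewrite /sc; case: pickP => [[x' y'] /= /andP[xy' /eqP e]|]; last first.
    by move/(_ (x, y)); rewrite /= xy eqxx.
  have := set21 x y; rewrite e !inE => /orP[]/eqP xE; subst x.
    by rewrite (set2_injr e).
  rewrite ecC //; congr ec; apply/esym/(@set2_injr y').
  by rewrite /= e setUC.
pose c : total_assignment G k.+1 :=
  [ffun x => inord (match x with inl v => vc v | inr e => sc (val e) end)].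
have cv v : vcolor c v = (vc v).+1 by rewrite /vcolor ffunE inordK ?ltnS.
have ce (e : edge G) : ecolor c e = (sc (val e)).+1.
  rewrite /ecolor ffunE inordK // ltnS.
  by case/edge_setP: (valP e) => x [y [xy ->]]; rewrite scE ?eck.
have cs v : color_sum c v = (vc v).+1 + \sum_(w | adj v w) (ec v w).+1.
  rewrite /color_sum cv; congr addn.
  rewrite (eq_bigr (fun e : edge G => (sc (val e)).+1)); last by move=> e _.
  rewrite (sum_incident_edges v (fun e => (sc e).+1)).
  by apply: eq_bigr => w vw; rewrite scE.
apply/existsP; exists c; apply/andP; split; last first.
  by apply/'forall_forallP => u v; apply/implyP => uv; rewrite !cs sumP.
apply/and3P; split; apply/'forall_forallP.
- by move=> u v; apply/implyP => uv; rewrite !cv eqSS vcP.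
- move=> e d; apply/implyP => /andP[eNd /set0Pn[x]]; rewrite inE => /andP[xe xd].
  have [v xv eE] := incident_edgeE (valP e) xe.
  have [w xw dE] := incident_edgeE (valP d) xd.
  rewrite !ce eE dE !scE // eqSS ecP //.
  by apply: contra_neq eNd => vw; apply: val_inj; rewrite eE dE vw.
- move=> v e; apply/implyP => ve; have [w vw eE] := incident_edgeE (valP e) ve.
  by rewrite cv ce eE scE // eqSS vecP.
Qed.

End SumTotalColoring.

(** * Sums over neighbors in Cartesian products and paths *)

Section ProductSums.
Set Implicit Arguments.
Unset Strict Implicit.

Lemma sum_cart_adj (G1 G2 : sgraph) (u : cart_prod G1 G2)
    (F : cart_prod G1 G2 -> nat) :
  \sum_(w | adj u w) F w =
  \sum_(j | adj u.1 j) F (j, u.2) + \sum_(s | adj u.2 s) F (u.1, s).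
Proof.
case: u => i t /=; rewrite (bigID (fun w : G1 * G2 => w.2 == t)) /=; congr addn.
  rewrite (reindex_onto (fun j => (j, t)) fst) /=; last first.
    by case=> j s /= /andP[_ /eqP->].
  apply: eq_bigl => j.
  by rewrite /cart_adj /= !eqxx !adj_irrefl !andbF !andbT.
rewrite (reindex_onto (fun s => (i, s)) snd) /=; last first.
  case=> j s /= /andP[]; rewrite /cart_adj /= => /orP[/andP[/eqP->]//|].
  by case/andP=> _ /eqP->; rewrite eqxx.
apply: eq_bigl => s; rewrite /cart_adj /= !eqxx !adj_irrefl /= orbF andbT.
by case ts: (adj t s) => //=; rewrite eq_sym; apply: adj_neq.
Qed.

Lemma sum_path_adj (n : nat) (t : 'I_n) (F : nat -> nat) :
  \sum_(s | path_adj t s) F s =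
  (if t.+1 < n then F t.+1 else 0) + (if 0 < t then F t.-1 else 0).
Proof.
rewrite (bigID (fun s : 'I_n => s == t.+1 :> nat)) /=; congr addn.
  rewrite -(big_ord1_eq addn); apply: eq_bigl => s.
  rewrite /path_adj; lia.
case: ltnP => [t0|t0].
  have tn : t.-1 < n by have := ltn_ord t; lia.
  rewrite -[RHS](_ : \sum_(s < n | s == t.-1 :> nat) F s = _).
    apply: eq_bigl => s; rewrite /path_adj; lia.
  by rewrite (big_ord1_eq addn) tn.
apply: big1 => s; rewrite /path_adj; lia.
Qed.

End ProductSums.

(** * Arithmetic of the colors modulo N *)

Section Coloring.
Set Implicit Arguments.
Unset Strict Implicit.
Variable m : nat.
Implicit Types i j s t : nat.

(* The residue of [x] modulo the odd number N = (m + odd m).+1, provided that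
   x < 2 * N (the subtraction is not iterated). *)
Definition wrap (x : nat) : nat :=
  if x <= m + odd m then x else x - (m + odd m).+1.

(* Colors are numbered from 0 here; [pred_color i] is i - 1 modulo N, and the
   residue used by [even_link] is i - 2, as N = m + 2 for odd m. *)
Definition double_color i := wrap (i + i).
Definition pred_color i := wrap (i + (m + odd m)).
Definition vertex_color i t := if odd t then pred_color i else double_color i.
Definition even_link i := if odd m then wrap (i + m) else m.+1.
Definition link_color i s := if odd s then m.+2 else even_link i.

Lemma wrap_le x : x <= m.*2 -> wrap x <= m + odd m.
Proof. rewrite /wrap; case: ifP; lia. Qed.

(** Translation by i is injective on residues. The residues used at the vertex i are translates of i
    by j, i, N - 1 or N - 2, so most clashes below are excluded by comparing these shifts. *)
Lemma wrap_inj i j k : i < m -> j <= m + odd m -> k <= m + odd m ->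
  wrap (i + j) = wrap (i + k) -> j = k.
Proof. rewrite /wrap; case: ifP; case: ifP; lia. Qed.

Lemma double_color_inj i j : i < m -> j < m ->
  double_color i = double_color j -> i = j.
Proof. rewrite /double_color /wrap; case: ifP; case: ifP; lia. Qed.

Lemma vertex_color_le i t : i < m -> vertex_color i t <= m.+1.
Proof.
rewrite /vertex_color /double_color /pred_color /wrap.
by case: ifP => _; case: ifP; lia.
Qed.

Lemma even_link_le i : i < m -> even_link i <= m.+1.
Proof. by rewrite /even_link /wrap; case: ifP => // _; case: ifP; lia. Qed.

Lemma vertex_color_inj i j t : i < m -> j < m ->
  vertex_color i t = vertex_color j t -> i = j.
Proof.
rewrite /vertex_color; case: ifP => _ im jm; last exact: double_color_inj.
rewrite /pred_color addnC [j + _]addnC /wrap; case: ifP; case: ifP; lia.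
Qed.

Lemma double_pred_neq i : i < m -> double_color i <> pred_color i.
Proof. by move=> im /wrap_inj; lia. Qed.

Lemma vertex_color_step i t : i < m -> vertex_color i t <> vertex_color i t.+1.
Proof.
rewrite /vertex_color /= => /double_pred_neq; case: (odd t) => //=.
by move=> ? /esym.
Qed.

Lemma vertex_color_row i j t : i < m -> j < m -> i != j ->
  vertex_color i t <> wrap (i + j).
Proof.
move=> im jm ij; rewrite /vertex_color; case: ifP => _ /wrap_inj; lia.
Qed.

Lemma vertex_color_link i s t : i < m -> vertex_color i t <> link_color i s.
Proof.
move=> im; have := vertex_color_le t im; rewrite /link_color; case: ifP; first lia.
(* For odd m the shifts are compared; for even m the spare color [m.+1] exceeds every residue. *)
move=> _ _; rewrite /even_link; case: ifP => mo.
  by rewrite /vertex_color; case: ifP => _ /wrap_inj; lia.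
rewrite /vertex_color /double_color /pred_color; case: ifP => _.
  by have := @wrap_le (i + (m + odd m)); lia.
by have := @wrap_le (i + i); lia.
Qed.

Lemma row_link i j s : i < m -> j < m -> wrap (i + j) <> link_color i s.
Proof.
move=> im jm; rewrite /link_color /even_link.
have wl : wrap (i + j) <= m + odd m by apply: wrap_le; lia.
case: ifP => _; first lia.
case: ifP => mo; last lia.
by move=> /wrap_inj; lia.
Qed.

Lemma link_step i s : i < m -> link_color i s <> link_color i s.+1.
Proof. by move=> /even_link_le; rewrite /link_color /=; case: (odd s) => /=; lia. Qed.

Lemma sum_wrap i : i < m ->
  \sum_(j < (m + odd m).+1) (wrap (i + j)).+1 = \sum_(j < (m + odd m).+1) j.+1.
Proof.
move=> im.
have wlt (j : 'I_(m + odd m).+1) : wrap (i + j) < (m + odd m).+1.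
  by have := ltn_ord j; rewrite /wrap; case: ifP; lia.
rewrite [RHS](reindex_inj (h := fun j : 'I__ => Ordinal (wlt j))) //.
move=> j k /(congr1 val) /= /wrap_inj e; apply/val_inj/e => //;
  by rewrite -ltnS ltn_ord.
Qed.

(** The vertex colors of two consecutive copies are 2i and i - 1 in some order. The first fills the
    diagonal gap j = i, the second is the shift N - 1, and [even_link] is the shift m for odd m or
    the extra color for even m: each of the first m + 2 colors occurs once. *)
Lemma row_sum (i : 'I_m) t :
  (vertex_color i t).+1 + \sum_(j < m | j != i) (wrap (i + j)).+1
    + (vertex_color i t.+1).+1 + (even_link i).+1 = \sum_(j < m.+2) j.+1.
Proof.
have -> : forall S, (vertex_color i t).+1 + S + (vertex_color i t.+1).+1 =
    (double_color i).+1 + S + (pred_color i).+1.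
  by move=> S; rewrite /vertex_color /=; case: (odd t) => /=; lia.
rewrite /double_color.
have := bigD1 i (F := fun j : 'I_m => (wrap (i + j)).+1) erefl.
rewrite /= => <-; have := sum_wrap (ltn_ord i).
rewrite /pred_color /even_link; case: (odd m) => /=; rewrite ?addn1 ?addn0.
  by rewrite !big_ord_recr /=; lia.
by rewrite !big_ord_recr /=; lia.
Qed.

(** * The coloring of the product and its sums *)

Variable n : nat.
Hypothesis n_gt1 : 1 < n.
Let G := cart_prod (complete_graph m) (path_graph n).

Definition prod_vcolor (u : G) : nat := vertex_color u.1 u.2.
Definition prod_ecolor (u w : G) : nat :=
  if u.2 == w.2 then wrap (u.1 + w.1) else link_color u.1 (minn u.2 w.2).

Lemma prod_adjP (u w : G) : adj u w ->
  [\/ u.2 = w.2 /\ u.1 != w.1 :> nat,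
      u.1 = w.1 /\ w.2 = u.2.+1 :> nat
    | u.1 = w.1 /\ u.2 = w.2.+1 :> nat].
Proof.
case/orP=> /andP[]; last by move=> ? /eqP; constructor 1.
by move/eqP=> ? /orP[]/eqP ?; [constructor 2 | constructor 3].
Qed.

Lemma sum_prod_adj (u : G) (F : G -> nat) (U D : nat) :
  (forall w : G, w.1 = u.1 -> w.2 = u.2.+1 :> nat -> F w = U) ->
  (forall w : G, w.1 = u.1 -> w.2.+1 = u.2 :> nat -> F w = D) ->
  \sum_(w | adj u w) F w = \sum_(j < m | j != u.1) F (j, u.2) +
    ((if u.2.+1 < n then U else 0) + (if 0 < u.2 then D else 0)).
Proof.
move=> FU FD; rewrite sum_cart_adj; congr addn.
  by apply: eq_bigl => j; rewrite /= /complete_adj eq_sym.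
(* Comparing s with [u.2] tells the direction of the link, which turns the summand into a function
   of the index alone. *)
rewrite (eq_bigr (fun s : 'I_n => if u.2 < s then U else D)).
  rewrite (sum_path_adj u.2 (fun s => if u.2 < s then U else D)) ltnSn.
  by rewrite [_ < _.-1]ltnNge leq_pred.
by move=> s /orP[]/eqP e; [rewrite FU // -e ltnSn | rewrite FD // -e ltnNge leqnSn].
Qed.

Lemma degree_prod (u : G) :
  degree u = m.-1 + ((u.2.+1 < n) + (0 < u.2)).
Proof.
rewrite /degree -sum1dep_card (@sum_prod_adj u _ 1 1) //; congr addn.
  by rewrite sum1_card cardC1 card_ord.
Qed.

Lemma max_degree_prod : 0 < m -> max_degree G = m + (2 < n).
Proof.
move=> m_gt0; apply/eqP; rewrite eqn_leq; apply/andP; split.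
  apply/bigmax_leqP => u _; rewrite degree_prod.
  by have := ltn_ord u.2; lia.
(* The copy of index 1 is interior if n > 2 and last if n = 2; its vertices have maximum degree in
   both cases. *)
pose u : G := (Ordinal m_gt0, Ordinal n_gt1).
apply: leq_trans (leq_bigmax u); rewrite degree_prod /=; lia.
Qed.

(* The label of [even_link] is absent exactly at the last copy when its index
   is even; the label m + 3 of the odd links is absent at the first copy and at
   the last one when its index is odd. *)
Lemma prod_color_sum (u : G) :
  (prod_vcolor u).+1 + \sum_(w | adj u w) (prod_ecolor u w).+1
    + (vertex_color u.1 u.2.+1).+1
    + (if ~~ odd u.2 && (u.2.+1 == n) then (even_link u.1).+1 else 0) =
  \sum_(j < m.+2) j.+1 +
    (if (0 < u.2) && (odd u.2 ==> (u.2.+1 < n)) then m.+3 else 0).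
Proof.
set t := nat_of_ord u.2; have tn : t < n by exact: ltn_ord.
rewrite (@sum_prod_adj u _ (link_color u.1 t).+1 (link_color u.1 t.-1).+1) /=.
- rewrite -/t -(row_sum u.1 t) /prod_vcolor /prod_ecolor /= eqxx -/t.
  move: (\sum_(j < m | _) _) => S; rewrite /link_color.
  case: t tn => [|t] /= tn; first by rewrite n_gt1 ltn_eqF //; lia.
  case: (ltngtP t.+2 n) tn => [tn _|tn|tn _]; last 1 first.
  - by case: (odd t) => /=; lia.
  - by case: (odd t) => /=; lia.
  - lia.
- move=> w _ w2; rewrite /prod_ecolor -val_eqE /= w2 ltn_eqF //.
  by rewrite (minn_idPl (leqnSn _)).
- move=> w _ w2; rewrite /prod_ecolor -val_eqE /= /t -w2 gtn_eqF //.
  by rewrite (minn_idPr (leqnSn _)).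
Qed.

(** Equal integer sums are congruent modulo N: this compares 2i - 3 with 2j - 3 for odd m, and i - 1
    with j - 1 for even m, where [even_link] is constant. *)
Lemma last_even_sum_inj i j : i < m -> j < m ->
  pred_color i + even_link i = pred_color j + even_link j -> i = j.
Proof.
rewrite /pred_color /even_link /wrap; case: ifP => mo.
  by do ![case: ifP => ?]; lia.
by do ![case: ifP => ?]; lia.
Qed.

(** For odd m the two sides are 2i and 2i - 2 modulo the odd N; for even m the right side exceeds
    every residue. This separates a last copy of even index from the copy below it. *)
Lemma last_even_sum_neq i : 1 < m -> i < m ->
  double_color i <> pred_color i + (even_link i).+1.
Proof.
rewrite /double_color /pred_color /even_link /wrap; case: ifP => mo.
  by do ![case: ifP => ?]; lia.
by do ![case: ifP => ?]; lia.
Qed.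

Lemma sum_total_coloring_prod :
  1 < m -> has_sum_total_coloring G (max_degree G + 2).
Proof.
move=> m_gt1; rewrite (max_degree_prod (ltnW m_gt1)) addn2.
have lt1 (u : G) : u.1 < m by exact: ltn_ord.
have lt2 (u : G) : u.2 < n by exact: ltn_ord.
have ecE (u w : G) : adj u w -> prod_ecolor u w = prod_ecolor w u.
  move=> /prod_adjP[[e _]|[e1 e2]|[e1 e2]]; rewrite /prod_ecolor.
  - by rewrite e eqxx addnC.
  - by rewrite eq_sym e1 minnC.
  - by rewrite eq_sym e1 minnC.
have ecU (u w : G) : u.1 = w.1 -> w.2 = u.2.+1 :> nat ->
    prod_ecolor u w = link_color u.1 u.2.
  move=> _ e; rewrite /prod_ecolor -val_eqE /= e ltn_eqF //.
  by rewrite (minn_idPl (leqnSn _)).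
have ecD (u w : G) : u.1 = w.1 -> u.2 = w.2.+1 :> nat ->
    prod_ecolor u w = link_color u.1 w.2.
  move=> _ e; rewrite /prod_ecolor -val_eqE /= e gtn_eqF //.
  by rewrite (minn_idPr (leqnSn _)).
have ecR (u w : G) : u.2 = w.2 -> prod_ecolor u w = wrap (u.1 + w.1).
  by move=> e; rewrite /prod_ecolor e eqxx.
apply: (@sum_total_coloring_of _ _ prod_vcolor prod_ecolor) => //.
- by move=> u; have := vertex_color_le u.2 (lt1 u); rewrite /prod_vcolor; lia.
- move=> u w /prod_adjP[[e _]|[e1 e2]|[e1 e2]].
  + rewrite ecR //; have : wrap (u.1 + w.1) <= m + odd m; last lia.
    by apply: wrap_le; have := lt1 u; have := lt1 w; lia.
  (* The color [m.+2] is within the bound because a link of odd index exists only if n > 2. *)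
  + rewrite ecU // /link_color; have := even_link_le (lt1 u); have := lt2 w.
    by case: ifP; lia.
  + rewrite ecD // /link_color; have := even_link_le (lt1 u); have := lt2 u.
    by case: ifP; lia.
- move=> u w /prod_adjP[[e /eqP ne]|[e1 e2]|[e1 e2]]; apply/eqP; rewrite /prod_vcolor.
  + by rewrite e => /vertex_color_inj h; apply/ne/h.
  + by rewrite e1 e2; apply: vertex_color_step.
  + by rewrite e1 e2 => /esym; apply: vertex_color_step.
(* Nine pairs of directions: two links in the same direction coincide, and opposite links have
   consecutive indices. *)
- move=> u v w /prod_adjP[[v2 v1]|[v1 v2]|[v1 v2]]
    /prod_adjP[[w2 w1]|[w1 w2]|[w1 w2]] vw; apply/eqP;
    rewrite ?(ecR _ _ v2) ?(ecR _ _ w2) ?(ecU _ _ v1 v2) ?(ecU _ _ w1 w2)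
            ?(ecD _ _ v1 v2) ?(ecD _ _ w1 w2).
  + move=> /wrap_inj h; case/eqP: vw; case: v w v1 v2 w1 w2 h => [v a] [w b] /=.
    move=> _ <- _ <- h; congr pair; apply/val_inj/h => //;
    by apply: ltnW; apply: leq_trans (ltn_ord _) (leq_addr _ _).
  + exact: row_link.
  + exact: row_link.
  + by move/esym; apply: row_link.
  + case/eqP: vw; case: v w v1 v2 w1 w2 => [v a] [w b] /= <- va <- wb.
    by congr pair; apply: val_inj; rewrite /= va wb.
  + by rewrite w2 => /esym; apply: link_step.
  + by move/esym; apply: row_link.
  + by rewrite v2; apply: link_step.
  + case/eqP: vw; case: v w v1 v2 w1 w2 => [v a] [w b] /= <- va <- wb.
    by congr pair; apply: val_inj; move: wb; rewrite /= va => -[].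
- move=> u w /prod_adjP[[e /eqP ne]|[e1 e2]|[e1 e2]]; apply/eqP; rewrite /prod_vcolor.
  + rewrite ecR //; exact/vertex_color_row/eqP.
  + rewrite ecU //; exact: vertex_color_link.
  + rewrite ecD //; exact: vertex_color_link.
have vertical (u w : G) : u.1 = w.1 -> w.2 = u.2.+1 :> nat ->
  (prod_vcolor u).+1 + \sum_(v | adj u v) (prod_ecolor u v).+1 <>
  (prod_vcolor w).+1 + \sum_(v | adj w v) (prod_ecolor w v).+1.
- move=> e1 e2 e; have := prod_color_sum u; have := prod_color_sum w.
  rewrite e; move: (_ + \sum_(v | _) _) => S; rewrite -e1 e2.
  move: (\sum_(j < _) _) => T; have := lt2 w; rewrite e2 => tn.
  have := @vertex_color_step u.1 u.2.+1 (lt1 u).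
  have := vertex_color_le u.2.+1 (lt1 u); have := vertex_color_le u.2.+2 (lt1 u).
  have := even_link_le (lt1 u).
  have := last_even_sum_neq m_gt1 (lt1 u).
  rewrite ltn0Sn tn (ltn_eqF tn) /vertex_color /=.
  (* The missing vertex colors differ and are at most m + 1, so they cannot offset a term m + 3
     present on one side only; [last_even_sum_neq] settles an upper copy that is last and of even
     index. *)
  case uo: (odd u.2) => /=; case: (ltngtP u.2.+2 n) => //=;
    case: (posnP u.2) uo => [->|_] //=; lia.
move=> u w /prod_adjP[[e2 /eqP ne]|[e1 e2]|[e1 e2]]; apply/eqP.
(* Within one copy the right-hand sides of [prod_color_sum] agree, so equal sums force equal totals
   of the missing colors. *)
- move=> e; have := prod_color_sum u; have := prod_color_sum w.
  rewrite e; move: (_ + \sum_(v | _) _) => S; rewrite -e2.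
  have vi := @vertex_color_inj u.1 w.1 u.2.+1 (lt1 u) (lt1 w).
  have li := @last_even_sum_inj u.1 w.1 (lt1 u) (lt1 w).
  case: ifP => [/andP[ev _]|_] <- h; apply: ne; last by apply: vi; lia.
  by apply: li; move: h; rewrite /vertex_color /= ev; lia.
- exact: vertical.
- by move/esym; apply: vertical.
Qed.

Lemma sum_total_coloring_prod_lb k :
  1 < m -> has_sum_total_coloring G k -> max_degree G + 2 <= k.
Proof.
move=> m_gt1; have m_gt0 := ltnW m_gt1.
pose u : G := (Ordinal m_gt0, Ordinal n_gt1).
pose v : G := (Ordinal m_gt1, Ordinal n_gt1).
have -> : max_degree G = degree u.
  by rewrite max_degree_prod // degree_prod /=; lia.
apply: (@sum_total_coloring_lb _ u v); last by rewrite !degree_prod.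
by apply/orP; right; rewrite eqxx.
Qed.

End Coloring.

Theorem theorem4p4 (m n : nat) (hm : 2 <= m) (hn : 2 <= n) :
  chi_sum_total (cart_prod (complete_graph m) (path_graph n)) =
  max_degree (cart_prod (complete_graph m) (path_graph n)) + 2.
Proof.
rewrite /chi_sum_total; case: ex_minnP => k kP kmin; apply/eqP.
rewrite eqn_leq kmin ?sum_total_coloring_prod //.
exact: sum_total_coloring_prod_lb.
Qed.
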